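(* Let $F$ be a field. The partial orderings $\preccurlyeq$ on the sets of morphisms turn $\mathcal C$ into a category enriched over partially ordered sets, and hence into a $2$-category. If $\mathbf{GrAlg}_F$ is regarded as a $2$-category with discrete hom-categories (the only $2$-cells are identities), then $L\colon\mathbf{GrAlg}_F\to\mathcal C$ is an oplax $2$-functor; in particular, for every pair $\varphi_1,\varphi_2$ of morphisms in $\mathbf{GrAlg}_F$ for which the composition $\varphi_1\varphi_2$ is defined, $$L(\varphi_1\varphi_2)\preccurlyeq L(\varphi_1)L(\varphi_2).$$
   Context: Algebras are associative over the field $F$, not necessarily unital. A grading on an algebra $A$ by a group $G$ is a decomposition $\Gamma\colon A=\bigoplus_{g\in G}A^{(g)}$ into a direct sum of subspaces with $A^{(g)}A^{(h)}\subseteq A^{(gh)}$ for all $g,h\in G$; $\operatorname{supp}\Gamma=\{g\in G\mid A^{(g)}\neq 0\}$. A homomorphism of algebras $\psi\colon A\to B$ between algebras graded by groups $G$ and $H$ is graded if for every $g\in G$ there exists $h\in H$ with $\psi(A^{(g)})\subseteq B^{(h)}$. $\mathbf{GrAlg}_F$ is the category whose objects are all gradings by arbitrary groups on associative $F$-algebras and whose morphisms are the graded homomorphisms. The category $\mathcal C$ is defined as follows. Objects are triples $(G,S,P)$ where $G$ is a group, $S\subseteq G$ is a subset, and $P\subseteq S\times S$ is a subset with $\{gh\mid (g,h)\in P\}\subseteq S$. Morphisms $(G_1,S_1,P_1)\to(G_2,S_2,P_2)$ are triples $(\psi,R,Q)$ where $R\subseteq S_1$, $Q\subseteq P_1\cap(R\times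 R)$, and $\psi\colon R\to S_2$ is a map such that $\{gh\mid(g,h)\in Q\}\subseteq R$, $\psi(g)\psi(h)=\psi(gh)$ for all $(g,h)\in Q$, and $\{(\psi(g),\psi(h))\mid(g,h)\in Q\}\subseteq P_2$. The identity morphism of $(G,S,P)$ is $(\mathrm{id}_S,S,P)$. The composition $(\psi,R,Q)=(\psi_2,R_2,Q_2)(\psi_1,R_1,Q_1)$ is given by $R=\{g\in R_1\mid\psi_1(g)\in R_2\}$, $Q=\{(g,h)\in Q_1\mid(\psi_1(g),\psi_1(h))\in Q_2\}$ and $\psi(g)=\psi_2(\psi_1(g))$ for $g\in R$. The partial ordering on each set of morphisms of $\mathcal C$: $(\psi_1,R_1,Q_1)\preccurlyeq(\psi_2,R_2,Q_2)$ if $R_1\subseteq R_2$, $Q_1\subseteq Q_2$ and $\psi_1=\psi_2|_{R_1}$. A poset is regarded as a category with a single morphism $m\to n$ if $m\preccurlyeq n$ and none otherwise; thus in $\mathcal C$ there is a (unique) $2$-cell from one $1$-cell to a parallel one exactly when the first is $\preccurlyeq$ the second. The map $L$: for $\Gamma\colon A=\bigoplus_{g\in G}A^{(g)}$ put $L(\Gamma):=(G,\operatorname{supp}\Gamma,\{(g_1,g_2)\in G\times G\mid A^{(g_1)}A^{(g_2)}\neq 0\})$. For a graded homomorphism $\varphi\colon\Gamma\to\Gamma_1$, where $\Gamma_1\colon B=\bigoplus_{h\in H}B^{(h)}$, put $L(\varphi)=(\psi,R,Q)$ where $R=\{g\in G\mid\varphi(A^{(g)})\neq 0\}$, $Q=\{(g_1,g_2)\in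 R\times R\mid\varphi(A^{(g_1)})\varphi(A^{(g_2)})\neq 0\}$ and $\psi$ is defined by $\varphi(A^{(g)})\subseteq B^{(\psi(g))}$ for $g\in R$. For an oplax $2$-functor, the comparison $2$-cells for composition go from $L(\varphi_1\varphi_2)$ to $L(\varphi_1)L(\varphi_2)$, and those for identities from $L(\mathrm{id}_\Gamma)$ to $\mathrm{id}_{L(\Gamma)}$, subject to the usual naturality and coherence conditions. *)

(* Defs.v *)
From HB Require Import structures.
From mathcomp Require Import all_boot all_order all_algebra.
From mathcomp Require Import boolp classical_sets functions cardinality fsbigop.

Set Implicit Arguments.
Unset Strict Implicit.
Unset Printing Implicit Defensive.

Import GRing.Theory.

Local Open Scope classical_set_scope.
Local Open Scope ring_scope.

Record precategory := Precategory {
  ob :> Type;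
  mor : ob -> ob -> Type;
  idm : forall A, mor A A;
  cmp : forall A B C, mor B C -> mor A B -> mor A C }.

Arguments mor {p} A B.
Arguments idm {p} A.
Arguments cmp {p A B C} g f.

Record is_category (C : precategory) : Prop := IsCategory {
  cmpA : forall (A B D E : C) (h : mor D E) (g : mor B D) (f : mor A B),
    cmp (cmp h g) f = cmp h (cmp g f);
  cmp1m : forall (A B : C) (f : mor A B), cmp (idm B) f = f;
  cmpm1 : forall (A B : C) (f : mor A B), cmp f (idm A) = f }.

Record is_poset_enriched (C : precategory)
    (le : forall A B : C, mor A B -> mor A B -> Prop) : Prop :=
  IsPosetEnriched {
  pe_cat : is_category C;
  pe_refl : forall (A B : C) (f : mor A B), le A B f f;
  pe_anti : forall (A B : C) (f g : mor A B),
    le A B f g -> le A B g f -> f = g;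
  pe_trans : forall (A B : C) (f g h : mor A B),
    le A B f g -> le A B g h -> le A B f h;
  pe_cmp : forall (A B D : C) (g g' : mor B D) (f f' : mor A B),
    le B D g g' -> le A B f f' -> le A D (cmp g f) (cmp g' f') }.

Record pre2category := Pre2category {
  onecells :> precategory;
  cell : forall A B : onecells, mor A B -> mor A B -> Type;
  idc : forall (A B : onecells) (f : mor A B), cell f f;
  vcmp : forall (A B : onecells) (f g h : mor A B),
    cell g h -> cell f g -> cell f h;
  hcmp : forall (A B D : onecells) (g g' : mor B D) (f f' : mor A B),
    cell g g' -> cell f f' -> cell (cmp g f) (cmp g' f') }.

Arguments cell {p A B} f g.
Arguments idc {p A B} f.
Arguments vcmp {p A B f g h} b a.
Arguments hcmp {p A B D g g' f f'} b a.

(* The identity 2-cell between provably equal 1-cells.  Horizontal            *)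
(* composition is associative and unital only up to these, since its source   *)
(* and target 1-cells are associative and unital only up to propositional     *)
(* equality.                                                                  *)
Definition eqcell (C : pre2category) (A B : C) (f g : mor A B) (e : f = g) :
    cell f g :=
  match e in _ = g' return cell f g' with erefl => idc f end.

Record two_category := TwoCategory {
  tc :> pre2category;
  tcP : is_category tc;
  vcmpA : forall (A B : tc) (f g h k : mor A B)
      (c : cell h k) (b : cell g h) (a : cell f g),
    vcmp (vcmp c b) a = vcmp c (vcmp b a);
  vcmp1 : forall (A B : tc) (f g : mor A B) (a : cell f g),
    vcmp (idc g) a = a;
  vcmpr1 : forall (A B : tc) (f g : mor A B) (a : cell f g),
    vcmp a (idc f) = a;
  hcmp_id : forall (A B D : tc) (g : mor B D) (f : mor A B),
    hcmp (idc g) (idc f) = idc (cmp g f);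
  interchange : forall (A B D : tc) (g g' g'' : mor B D) (f f' f'' : mor A B)
      (b' : cell g' g'') (b : cell g g') (a' : cell f' f'') (a : cell f f'),
    hcmp (vcmp b' b) (vcmp a' a) = vcmp (hcmp b' a') (hcmp b a);
  hcmpA : forall (A B D E : tc) (h h' : mor D E) (g g' : mor B D)
      (f f' : mor A B) (c : cell h h') (b : cell g g') (a : cell f f'),
    vcmp (eqcell (cmpA tcP h' g' f')) (hcmp (hcmp c b) a) =
    vcmp (hcmp c (hcmp b a)) (eqcell (cmpA tcP h g f));
  hcmp1 : forall (A B : tc) (f f' : mor A B) (a : cell f f'),
    vcmp (eqcell (cmp1m tcP f')) (hcmp (idc (idm B)) a) =
    vcmp a (eqcell (cmp1m tcP f));
  hcmpr1 : forall (A B : tc) (f f' : mor A B) (a : cell f f'),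
    vcmp (eqcell (cmpm1 tcP f')) (hcmp a (idc (idm A))) =
    vcmp a (eqcell (cmpm1 tcP f)) }.

Definition poset_pre2category (C : precategory)
    (le : forall A B : C, mor A B -> mor A B -> Prop)
    (hC : is_poset_enriched le) : pre2category :=
  @Pre2category C (fun A B f g => le A B f g)
    (fun A B f => pe_refl hC f)
    (fun A B f g h b a => pe_trans hC a b)
    (fun A B D g g' f f' b a => pe_cmp hC b a).

Definition poset_two_category (C : precategory)
    (le : forall A B : C, mor A B -> mor A B -> Prop)
    (hC : is_poset_enriched le) : two_category.
Proof.
by apply: (@TwoCategory (poset_pre2category hC) (pe_cat hC)) => * /=;
  exact: Prop_irrelevance.
Defined.

Definition discrete_pre2category (C : precategory) : pre2category :=
  @Pre2category C (fun A B f g => f = g)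
    (fun A B f => erefl f)
    (fun A B f g h b a => etrans a b)
    (fun A B D g g' f f' b a => f_equal2 cmp b a).

Definition discrete_two_category (C : precategory) (hC : is_category C) :
  two_category.
Proof.
by apply: (@TwoCategory (discrete_pre2category C) hC) => * /=;
  exact: Prop_irrelevance.
Defined.

(* Oplax 2-functors with prescribed action F0 on objects and F1 on 1-cells.   *)
Record oplax_functor (C D : two_category) (F0 : C -> D)
    (F1 : forall A B : C, mor A B -> mor (F0 A) (F0 B)) := OplaxFunctor {
  F2 : forall (A B : C) (f g : mor A B),
    cell f g -> cell (F1 A B f) (F1 A B g);
  F2_id : forall (A B : C) (f : mor A B),
    F2 (idc f) = idc (F1 A B f);
  F2_vcmp : forall (A B : C) (f g h : mor A B) (b : cell g h) (a : cell f g),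
    F2 (vcmp b a) = vcmp (F2 b) (F2 a);
  ox_cmp : forall (A B E : C) (g : mor B E) (f : mor A B),
    cell (F1 A E (cmp g f)) (cmp (F1 B E g) (F1 A B f));
  ox_id : forall A : C, cell (F1 A A (idm A)) (idm (F0 A));
  ox_natural : forall (A B E : C) (g g' : mor B E) (f f' : mor A B)
      (b : cell g g') (a : cell f f'),
    vcmp (ox_cmp g' f') (F2 (hcmp b a)) =
    vcmp (hcmp (F2 b) (F2 a)) (ox_cmp g f);
  ox_assoc : forall (A B E K : C) (h : mor E K) (g : mor B E) (f : mor A B),
    vcmp (eqcell (cmpA (tcP D) (F1 E K h) (F1 B E g) (F1 A B f)))
      (vcmp (hcmp (ox_cmp h g) (idc (F1 A B f))) (ox_cmp (cmp h g) f)) =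
    vcmp (hcmp (idc (F1 E K h)) (ox_cmp g f))
      (vcmp (ox_cmp h (cmp g f)) (F2 (eqcell (cmpA (tcP C) h g f))));
  ox_unitl : forall (A B : C) (f : mor A B),
    vcmp (eqcell (cmp1m (tcP D) (F1 A B f)))
      (vcmp (hcmp (ox_id B) (idc (F1 A B f))) (ox_cmp (idm B) f)) =
    F2 (eqcell (cmp1m (tcP C) f));
  ox_unitr : forall (A B : C) (f : mor A B),
    vcmp (eqcell (cmpm1 (tcP D) (F1 A B f)))
      (vcmp (hcmp (idc (F1 A B f)) (ox_id A)) (ox_cmp f (idm A))) =
    F2 (eqcell (cmpm1 (tcP C) f)) }.

Record triple := Triple {
  grp : groupType;
  elts : set grp;
  prs : set (grp * grp);
  prs_sub : prs `<=` elts `*` elts;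
  prs_mul : [set (p.1 * p.2)%g | p in prs] `<=` elts }.

Arguments elts : clear implicits.
Arguments prs : clear implicits.

(* [fn] is a map between the subsets R and S_2, seen as types; elements of R  *)
(* are pairs of a group element and a membership proof, projected by [val].   *)
Record triple_hom (X Y : triple) := TripleHom {
  dom : set (grp X);
  dprs : set (grp X * grp X);
  fn : dom -> elts Y;
  dom_sub : dom `<=` elts X;
  dprs_sub : dprs `<=` prs X `&` (dom `*` dom);
  dprs_mul : [set (p.1 * p.2)%g | p in dprs] `<=` dom;
  fn_mul : forall g h k : dom, dprs (val g, val h) ->
    val k = (val g * val h)%g -> val (fn k) = (val (fn g) * val (fn h))%g;
  fn_prs : forall g h : dom, dprs (val g, val h) ->
    prs Y (val (fn g), val (fn h)) }.

Arguments fn {X Y} t _.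

Lemma triple_hom_eq (X Y : triple) (m n : triple_hom X Y) :
  dom m = dom n -> dprs m = dprs n ->
  (forall (g : dom m) (h : dom n), val g = val h ->
     val (fn m g) = val (fn n h)) -> m = n.
Proof.
case: m n => [R Q f a b c d e] [R' Q' f' a' b' c' d' e'] /= eR eQ.
subst R' Q' => ef; have eff : f = f'.
  by apply/funext => g; apply: val_inj; exact: ef.
by subst f'; congr TripleHom; exact: Prop_irrelevance.
Qed.

Definition mkset_type (T : Type) (A : set T) (x : T) (Ax : A x) : A :=
  exist (fun y => y \in A) x (mem_set Ax).

Definition triple_id (X : triple) : triple_hom X X.
Proof.
apply: (@TripleHom X X (elts X) (prs X) id) => //.
- by move=> p Pp; split=> //; exact: prs_sub.
- exact: prs_mul.
Defined.

Section TripleComp.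
Variables (X Y Z : triple) (n : triple_hom Y Z) (m : triple_hom X Y).

Definition comp_dom : set (grp X) :=
  [set g | exists Rg : g \in dom m, dom n (val (fn m (exist _ g Rg)))].

Definition comp_dprs : set (grp X * grp X) :=
  [set p | dprs m p /\
    exists g h : dom m, p = (val g, val h) /\
      dprs n (val (fn m g), val (fn m h))].

Lemma comp_dom1 (g : comp_dom) : val g \in dom m.
Proof. by case: g => g /= /set_mem[]. Qed.

Definition comp_arg1 (g : comp_dom) : dom m := exist _ (val g) (comp_dom1 g).

Lemma comp_dom2 (g : comp_dom) : val (fn m (comp_arg1 g)) \in dom n.
Proof.
apply/mem_set; case: g => g Rg; case: (set_mem Rg) => R1 R2.
by rewrite (_ : comp_arg1 _ = exist _ g R1) //; exact: val_inj.
Qed.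

Definition comp_fn (g : comp_dom) : elts Z :=
  fn n (exist _ (val (fn m (comp_arg1 g))) (comp_dom2 g)).

Lemma mem_comp_dom (g : dom m) : dom n (val (fn m g)) -> comp_dom (val g).
Proof. by case: g => g Rg H; exists Rg. Qed.

Definition triple_comp : triple_hom X Z.
Proof.
apply: (@TripleHom X Z comp_dom comp_dprs comp_fn).
- by move=> g [/set_mem Rg _]; exact: dom_sub Rg.
- move=> p [Qp [g [h [ep Q2]]]]; subst p; have [Pp _] := dprs_sub Qp.
  have [_ [/= R1 R2]] := dprs_sub Q2.
  by split=> //; split=> /=; exact: mem_comp_dom.
- move=> _ [p [Qp [g [h [ep Q2]]]] <-]; subst p => /=.
  have Rgh : dom m (val g * val h)%g.
    by apply: (dprs_mul (t := m)); exists (val g, val h).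
  exists (mem_set Rgh).
  rewrite (fn_mul (g := g) (h := h)) //.
  by apply: (dprs_mul (t := n)); exists (val (fn m g), val (fn m h)).
- move=> g h k [Qgh [g' [h' [[eg eh] Q2]]]] ek; apply: fn_mul => /=.
    rewrite (_ : comp_arg1 g = g'); last exact: val_inj.
    by rewrite (_ : comp_arg1 h = h') //; exact: val_inj.
  exact: fn_mul.
- move=> g h [Qgh [g' [h' [[eg eh] Q2]]]]; apply: fn_prs => /=.
  rewrite (_ : comp_arg1 g = g'); last exact: val_inj.
  by rewrite (_ : comp_arg1 h = h') //; exact: val_inj.
Defined.

End TripleComp.

Definition tripleCat : precategory := Precategory triple_id triple_comp.

Definition prec (X Y : tripleCat) (m n : mor X Y) : Prop :=
  [/\ dom m `<=` dom n, dprs m `<=` dprs n &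
    forall (g : dom m) (h : dom n), val g = val h -> fn m g = fn n h].

Record assoc_alg (F : fieldType) := AssocAlg {
  carrier :> lmodType F;
  amul : carrier -> carrier -> carrier;
  amulA : associative amul;
  amul_linearl : forall y, linear (fun x => amul x y);
  amul_linearr : forall x, linear (amul x) }.

Definition is_subspace (F : fieldType) (V : lmodType F) (U : set V) : Prop :=
  U 0 /\ forall (a : F) x y, U x -> U y -> U (a *: x + y).

(* The product UV of sets of elements: finite sums of products uv.  For       *)
(* subspaces U and V this is the linear span of all the uv.                   *)
Definition prod_space (F : fieldType) (A : assoc_alg F) (U V : set A) : set A :=
  [set x | exists s : seq (A * A),
     (forall p, p \in s -> U p.1 /\ V p.2) /\
     x = \sum_(p <- s) amul p.1 p.2].

(* [gr_direct] is the direct sum decomposition.  The finiteness condition is  *)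
(* needed because the \sum over an infinite support is 0 by convention.       *)
Record grading (F : fieldType) := Grading {
  gr_grp : groupType;
  gr_alg : assoc_alg F;
  gr_comp : gr_grp -> set gr_alg;
  gr_subspace : forall g, is_subspace (gr_comp g);
  gr_direct : forall x : gr_alg, exists! c : gr_grp -> gr_alg,
    [/\ forall g, gr_comp g (c g), finite_set [set g | c g <> 0] &
        x = \sum_(g \in [set: gr_grp]) c g];
  gr_mul : forall g h,
    prod_space (gr_comp g) (gr_comp h) `<=` gr_comp (g * h)%g }.

Arguments gr_comp {F} _ _ _.
Arguments gr_subspace {F} _ _.

Definition supp (F : fieldType) (A : grading F) : set (gr_grp A) :=
  [set g | gr_comp A g <> [set 0]].

Record graded_hom (F : fieldType) (A B : grading F) := GradedHom {
  gfun :> gr_alg A -> gr_alg B;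
  gfun_linear : linear gfun;
  gfun_mul : {morph gfun : x y / amul x y};
  gfun_graded : forall g, exists h, gfun @` gr_comp A g `<=` gr_comp B h }.

Lemma graded_hom_eq (F : fieldType) (A B : grading F) (f g : graded_hom A B) :
  f =1 g -> f = g.
Proof.
case: f g => [f a b c] [g a' b' c'] /= /funext efg; subst g.
by congr GradedHom; exact: Prop_irrelevance.
Qed.

Definition graded_id (F : fieldType) (A : grading F) : graded_hom A A.
Proof.
apply: (@GradedHom F A A id) => // g.
by exists g => x [y Ay <-].
Defined.

Definition graded_comp (F : fieldType) (A B C : grading F)
  (f2 : graded_hom B C) (f1 : graded_hom A B) : graded_hom A C.
Proof.
apply: (@GradedHom F A C (fun x => f2 (f1 x))).
- by move=> a x y /=; rewrite !gfun_linear.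
- by move=> x y /=; rewrite !gfun_mul.
- move=> g; have [h fh] := gfun_graded f1 g; have [k fk] := gfun_graded f2 h.
  exists k => _ [x Ax <-]; apply: fk; exists (f1 x) => //.
  by apply: fh; exists x.
Defined.

Definition GrAlg (F : fieldType) : precategory :=
  Precategory (@graded_id F) (@graded_comp F).

Lemma GrAlg_category (F : fieldType) : is_category (GrAlg F).
Proof. by split=> *; exact: graded_hom_eq. Qed.

Section LMap.
Variable F : fieldType.

Lemma nonzero_set (V : zmodType) (U : set V) :
  U 0 -> U <> [set 0] <-> exists2 u, U u & u <> 0.
Proof.
move=> U0; split=> [nU|[u Uu u0] eU]; last by rewrite eU in Uu.
apply: contrapT => H; apply: nU; apply/seteqP; split=> [u Uu|_ -> //].
by apply: contrapT => u0; apply: H; exists u.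
Qed.

Lemma prod_nonzero (A : assoc_alg F) (U V : set A) :
  prod_space U V <> [set 0] <->
  exists u v, [/\ U u, V v & amul u v <> 0].
Proof.
rewrite nonzero_set; last by exists [::]; split=> //; rewrite big_nil.
split=> [[x [s [sUV ->]] nz]|[u [v [Uu Vv nz]]]].
  apply: contrapT => H; apply: nz; rewrite big_seq big1 // => p ps.
  apply: contrapT => nz; have [Up Vp] := sUV p ps.
  by apply: H; exists p.1, p.2.
exists (amul u v) => //; exists [:: (u, v)]; split; last by rewrite big_seq1.
by move=> p; rewrite inE => /eqP ->.
Qed.

Lemma gr_mul1 (A : grading F) g h x y :
  gr_comp A g x -> gr_comp A h y -> gr_comp A (g * h)%g (amul x y).
Proof.
move=> Ax Ay; apply: gr_mul; exists [:: (x, y)]; split; last by rewrite big_seq1.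
by move=> p; rewrite inE => /eqP ->.
Qed.

Lemma gr_disjoint (A : grading F) g h x :
  gr_comp A g x -> gr_comp A h x -> x <> 0 -> g = h.
Proof.
move=> Agx Ahx nzx; have [c [_ cU]] := gr_direct x.
have single k : gr_comp A k x -> c = fun l => if l == k then x else 0.
  move=> Akx; apply: cU; split.
  - by move=> l; case: eqP => [->|_] //; case: (gr_subspace A l).
  - apply: (sub_finite_set (B := [set k])); last exact: finite_set1.
    by move=> l /=; case: eqP.
  - rewrite -(fsbig_widen [set k] setT) //; first by rewrite fsbig_set1 eqxx.
    by move=> l /= [_ /eqP]; case: eqP.
move: (single g Agx); rewrite (single h Ahx) => /(congr1 (@^~ h)).
by rewrite eqxx; case: eqP => [->|_ /nzx].
Qed.

Lemma gfun0 (A B : grading F) (f : graded_hom A B) : f 0 = 0.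
Proof.
have := gfun_linear f 1 0 0; rewrite !scale1r !addr0 => e.
by apply: (@addrI _ (f 0)); rewrite addr0 -e.
Qed.

Lemma gfun_nz (A B : grading F) (f : graded_hom A B) g :
  f @` gr_comp A g <> [set 0] <-> exists2 x, gr_comp A g x & f x <> 0.
Proof.
rewrite nonzero_set; last first.
  by exists 0; [case: (gr_subspace A g)|exact: gfun0].
split=> [[_ [x Ax <-]] nz|[x Ax nz]]; first by exists x.
by exists (f x) => //; exists x.
Qed.

Definition L_prs (A : grading F) : set (gr_grp A * gr_grp A) :=
  [set p | prod_space (gr_comp A p.1) (gr_comp A p.2) <> [set 0]].

Lemma gr_supp (A : grading F) (g : gr_grp A) x :
  gr_comp A g x -> x <> 0 -> supp g.
Proof.
move=> Ax nz; rewrite /supp /= nonzero_set; first by exists x.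
by case: (gr_subspace A g).
Qed.

Lemma L_prs_sub (A : grading F) : @L_prs A `<=` @supp F A `*` @supp F A.
Proof.
move=> p /prod_nonzero[x [y [Ax Ay nz]]]; split.
  apply: gr_supp Ax _ => x0; apply: nz; rewrite x0.
  by have := amul_linearl y (-1) 0 0; rewrite /= !scaleN1r !addNr.
apply: gr_supp Ay _ => y0; apply: nz; rewrite y0.
by have := amul_linearr x (-1) 0 0; rewrite /= !scaleN1r !addNr.
Qed.

Lemma L_prs_mul (A : grading F) :
  [set (p.1 * p.2)%g | p in @L_prs A] `<=` @supp F A.
Proof.
move=> _ [p /prod_nonzero[x [y [Ax Ay nz]]] <-].
exact: gr_supp (gr_mul1 Ax Ay) nz.
Qed.

Definition L_ob (A : grading F) : triple := Triple (@L_prs_sub A) (@L_prs_mul A).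

Section LHom.
Variables (A B : grading F) (f : graded_hom A B).

Definition L_dom : set (gr_grp A) :=
  [set g | f @` gr_comp A g <> [set 0]].

Definition L_dprs : set (gr_grp A * gr_grp A) :=
  [set p | [/\ L_dom p.1, L_dom p.2 &
    prod_space (f @` gr_comp A p.1) (f @` gr_comp A p.2) <> [set 0]]].

(* Some h such that f maps the component of degree g into that of degree h;   *)
(* it is unique when g belongs to [L_dom] (see [L_deg_uniq]).                 *)
Definition L_deg (g : gr_grp A) : gr_grp B := projT1 (cid (gfun_graded f g)).

Lemma L_degP g : f @` gr_comp A g `<=` gr_comp B (L_deg g).
Proof. exact: projT2 (cid (gfun_graded f g)). Qed.

Lemma L_deg_uniq g h :
  L_dom g -> f @` gr_comp A g `<=` gr_comp B h -> L_deg g = h.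
Proof.
move=> /gfun_nz[x Ax nz] fh.
by apply: gr_disjoint nz; [apply: L_degP|apply: fh]; exists x.
Qed.

Lemma L_deg_supp g : L_dom g -> supp (L_deg g).
Proof.
move=> /gfun_nz[x Ax nz]; rewrite /supp /= nonzero_set.
  by exists (f x) => //; apply: L_degP; exists x.
by case: (gr_subspace B (L_deg g)).
Qed.

Definition L_fn (g : L_dom) : elts (L_ob B) :=
  @mkset_type _ (@supp F B) (L_deg (val g)) (L_deg_supp (set_mem (valP g))).

Definition L_hom : triple_hom (L_ob A) (L_ob B).
Proof.
apply: (@TripleHom (L_ob A) (L_ob B) L_dom L_dprs L_fn).
- move=> g /gfun_nz[x Ax nz]; rewrite /= /supp /= nonzero_set.
    by exists x => // x0; apply: nz; rewrite x0 gfun0.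
  by case: (gr_subspace A g).
- move=> p [R1 R2 /prod_nonzero[_ [_ [[x Ax <-] [y Ay <-] nz]]]]; split=> //.
  apply/prod_nonzero; exists x, y; split=> // xy0.
  by apply: nz; rewrite -gfun_mul xy0 gfun0.
- move=> _ [p [R1 R2 /prod_nonzero[_ [_ [[x Ax <-] [y Ay <-] nz]]]] <-].
  apply/gfun_nz; exists (amul x y); first exact: gr_mul1.
  by rewrite gfun_mul.
- move=> g h k [R1 R2 /prod_nonzero[_ [_ [[x Ax <-] [y Ay <-] nz]]]] /= ek.
  have Axy := gr_mul1 Ax Ay; apply: gr_disjoint nz.
    by rewrite -gfun_mul; apply: L_degP; exists (amul x y) => //; rewrite ek.
  by apply: gr_mul1; apply: L_degP; [exists x|exists y].
- move=> g h [R1 R2 /prod_nonzero[_ [_ [[x Ax <-] [y Ay <-] nz]]]] /=.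
  apply/prod_nonzero; exists (f x), (f y).
  by split=> //; apply: L_degP; [exists x|exists y].
Defined.

End LHom.
End LMap.

Definition L0 (F : fieldType) (A : GrAlg F) : tripleCat := L_ob A.

Definition L1 (F : fieldType) (A B : GrAlg F) (f : mor A B) :
  mor (L0 A) (L0 B) := L_hom f.

(* Main.v *)
Require Import Defs.
From mathcomp Require Import all_boot all_order all_algebra.
From mathcomp Require Import boolp classical_sets.

(** A morphism (psi, R, Q) of triples is determined by the graph of the partial
    map psi, a binary relation, together with the binary relation Q.  In these
    terms composition is composition of relations on the first component and
    pulling back along the graph on the second ([graph_comp], [dprs_comp]),
    while the ordering is inclusion in both components ([precE]).  The laws of
    a category enriched over posets thus reduce to those of binary relations.

    For a graded homomorphism f, the graph of L(f) relates g to h when some x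
    of degree g has a nonzero image of degree h ([graph_L]), and Q relates g to
    h when f x * f y <> 0 for some x of degree g and y of degree h ([dprs_L]).
    An element witnessing that a pair belongs to L(f1 f2) also witnesses that
    it belongs to L(f1) L(f2): if f1 (f2 x) <> 0 then f2 x <> 0, and
    f1 (f2 x) * f1 (f2 y) <> 0 forces f2 x * f2 y <> 0.  Equality may fail,
    since L(f1) L(f2) only asks for one element that f2 does not kill and
    another element, of the target degree, that f1 does not kill.  The comparison
    2-cells live in posets, so all coherence conditions hold automatically. *)

Set Implicit Arguments.
Unset Strict Implicit.
Unset Printing Implicit Defensive.

Import GRing.Theory.

Local Open Scope classical_set_scope.
Local Open Scope ring_scope.

(** * Morphisms of triples as pairs of relations *)

Section Graph.

(** Encoding the partial map by its graph removes the proofs of membership in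
    the domain, over which the map itself is defined. *)
Definition graph (X Y : triple) (m : triple_hom X Y) (g : grp X) (h : grp Y) :
    Prop :=
  exists Rg : g \in dom m, val (fn m (exist _ g Rg)) = h.

Variables X Y : triple.
Implicit Types m n : triple_hom X Y.

Lemma graph_val m (g : dom m) : graph m (val g) (val (fn m g)).
Proof. by case: g => g Rg; exists Rg. Qed.

Lemma graph_dom m g h : graph m g h -> dom m g.
Proof. by case=> Rg _; exact: set_mem Rg. Qed.

Lemma dom_graph m g : dom m g -> exists h, graph m g h.
Proof. by move=> /mem_set Rg; eexists; exists Rg. Qed.

Lemma graph_fun m g h h' : graph m g h -> graph m g h' -> h = h'.
Proof. by case=> R <- [R' <-]; congr (val (fn m _)); exact: val_inj. Qed.

Lemma dprs_graph m p : dprs m p ->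
  exists a b, graph m p.1 a /\ graph m p.2 b.
Proof.
move=> /dprs_sub[_ [/dom_graph[a ga] /dom_graph[b gb]]].
by exists a, b.
Qed.

Lemma precE m n :
  @prec X Y m n <->
  (forall g h, graph m g h -> graph n g h) /\ dprs m `<=` dprs n.
Proof.
split=> [[sR sQ e]|[sg sQ]].
  split=> // g h [Rg <-].
  exists (mem_set (sR _ (set_mem Rg))).
  by rewrite (e (exist _ g Rg) (exist _ g (mem_set (sR _ (set_mem Rg))))).
split=> // [g /dom_graph[h /sg/graph_dom]//|g h e].
apply: val_inj; apply: (graph_fun (m := n) (g := val h)); last exact: graph_val.
by rewrite -e; apply: sg; exact: graph_val.
Qed.

Lemma prec_anti m n : @prec X Y m n -> @prec X Y n m -> m = n.
Proof.
move=> [sR sQ e] [sR' sQ' _]; apply: triple_hom_eq.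
- exact/seteqP.
- exact/seteqP.
- by move=> g h gh; rewrite (e g h).
Qed.

(** Equality of morphisms as equality of relations, avoiding transport along an
    equality of domains. *)
Lemma graph_inj m n :
  (forall g h, graph m g h <-> graph n g h) ->
  (forall p, dprs m p <-> dprs n p) -> m = n.
Proof.
move=> eg eQ; apply: prec_anti; apply/precE; split=> [g h|p].
- by move/eg.
- by move/eQ.
- by move/eg.
- by move/eQ.
Qed.

End Graph.

Lemma graph_id (X : triple) g h : graph (triple_id X) g h <-> elts X g /\ g = h.
Proof.
split=> [[Rg <-]|[Xg <-]]; first by split=> //; exact: set_mem Rg.
by exists (mem_set Xg).
Qed.

Lemma graph_comp (X Y Z : triple) (n : triple_hom Y Z) (m : triple_hom X Y) g k :
  graph (triple_comp n m) g k <-> exists2 h, graph m g h & graph n h k.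
Proof.
split=> [[Rg <-]|[h [Rg <-] [Rh <-]]].
  rewrite /= /comp_fn /=; eexists; last exact: graph_val.
  exact: (graph_val (comp_arg1 (exist _ g Rg))).
have Cg : comp_dom n m g by exists Rg; exact: set_mem Rh.
exists (mem_set Cg); rewrite /= /comp_fn.
congr (val (fn n _)); apply: val_inj => /=.
by congr (val (fn m _)); exact: val_inj.
Qed.

(** Since graphs are functional, a and b are the images of the two components
    of p; quantifying over them lets associativity be proved without choosing
    membership proofs. *)
Lemma dprs_comp (X Y Z : triple) (n : triple_hom Y Z) (m : triple_hom X Y) p :
  dprs (triple_comp n m) p <->
  dprs m p /\ exists a b, [/\ graph m p.1 a, graph m p.2 b & dprs n (a, b)].
Proof.
split=> [[Qp [g [h [ep Qn]]]]|[Qp [_ [_ [[Rg <-] [Rh <-] Qn]]]]].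
  split=> //; rewrite ep.
  by do 2 eexists; split; [exact: graph_val|exact: graph_val|].
split=> //; exists (exist _ p.1 Rg), (exist _ p.2 Rh).
by split=> //; exact: surjective_pairing.
Qed.

(** * The enrichment over posets *)

Lemma triple_compA (X Y Z T : triple) (l : triple_hom Z T)
    (n : triple_hom Y Z) (m : triple_hom X Y) :
  triple_comp (triple_comp l n) m = triple_comp l (triple_comp n m).
Proof.
apply: graph_inj => [g k|p]; rewrite ?graph_comp ?dprs_comp.
  split=> [[a ma /graph_comp[b nb lb]]|[b /graph_comp[a ma nb] lb]].
    by exists b => //; apply/graph_comp; exists a.
  by exists a => //; apply/graph_comp; exists b.
split.
  move=> [Qm [a [b [ma mb /dprs_comp[Qn [c [d [nc nd Ql]]]]]]]].
  split; first by split=> //; exists a, b.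
  by exists c, d; split=> //; apply/graph_comp; [exists a|exists b].
move=> [[Qm [a [b [ma mb Qn]]]] [c [d [/graph_comp[a' ma' nc]
  /graph_comp[b' mb' nd] Ql]]]].
split=> //; exists a, b; split=> //; apply/dprs_comp; split=> //.
exists c, d; split=> //=.
- by rewrite (graph_fun ma ma').
- by rewrite (graph_fun mb mb').
Qed.

Lemma triple_comp1m (X Y : triple) (m : triple_hom X Y) :
  triple_comp (triple_id Y) m = m.
Proof.
apply: graph_inj => [g k|[g h]]; rewrite ?graph_comp ?dprs_comp.
  split=> [[h mh /graph_id[_ <-]]//|mk].
  exists k => //; apply/graph_id; split=> //.
  by case: mk => Rg <-; exact: set_mem (valP (fn m _)).
split=> [[]//|Qm]; split=> //.
have [_ [/mem_set Rg /mem_set Rh]] := dprs_sub Qm.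
exists (val (fn m (exist _ g Rg))), (val (fn m (exist _ h Rh))).
by split; [exists Rg|exists Rh|exact: fn_prs].
Qed.

Lemma triple_compm1 (X Y : triple) (m : triple_hom X Y) :
  triple_comp m (triple_id X) = m.
Proof.
apply: graph_inj => [g k|[g h]]; rewrite ?graph_comp ?dprs_comp.
  split=> [[h /graph_id[_ <-]]//|mk].
  by exists g => //; apply/graph_id; split=> //; exact: dom_sub (graph_dom mk).
split=> [[_ [a [b [/graph_id[_ <-] /graph_id[_ <-]]]]]//|Qm].
have [Pgh _] := dprs_sub Qm; have [Xg Xh] := prs_sub Pgh.
by split=> //; exists g, h; split=> //; exact/graph_id.
Qed.

Lemma triple_category : is_category tripleCat.
Proof.
by split=> *; [exact: triple_compA|exact: triple_comp1m|exact: triple_compm1].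
Qed.

Lemma prec_comp (X Y Z : triple) (n n' : triple_hom Y Z) (m m' : triple_hom X Y) :
  @prec Y Z n n' -> @prec X Y m m' ->
  @prec X Z (triple_comp n m) (triple_comp n' m').
Proof.
move=> /precE[sn sQn] /precE[sm sQm]; apply/precE; split=> [g k|p].
  move=> /graph_comp[h mh nk]; apply/graph_comp.
  by exists h; [exact: sm|exact: sn].
move=> /dprs_comp[Qm [a [b [ma mb Qn]]]]; apply/dprs_comp.
split; first exact: sQm.
by exists a, b; split; [exact: sm|exact: sm|exact: sQn].
Qed.

Lemma prec_enriched : is_poset_enriched prec.
Proof.
split.
- exact: triple_category.
- by move=> X Y m; apply/precE; split.
- exact: prec_anti.
- move=> X Y m n l /precE[s1 t1] /precE[s2 t2]; apply/precE.
  by split=> [g h /s1/s2|p /t1/t2].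
- exact: prec_comp.
Qed.

(** * The map L on graded homomorphisms *)

Section LMapGraph.
Variable F : fieldType.

Lemma amul0l (A : assoc_alg F) (y : A) : amul 0 y = 0.
Proof. by have := amul_linearl y (-1) 0 0; rewrite /= !scaleN1r !addNr. Qed.

Lemma amul0r (A : assoc_alg F) (x : A) : amul x 0 = 0.
Proof. by have := amul_linearr x (-1) 0 0; rewrite /= !scaleN1r !addNr. Qed.

(** A nonzero element has only one degree, so any degree h of f x agrees with
    the one selected by [L_deg]; this frees the later proofs from that choice. *)
Lemma graph_L (A B : grading F) (f : graded_hom A B) g h :
  graph (L_hom f) g h <->
  exists x, [/\ gr_comp A g x, gr_comp B h (f x) & f x <> 0].
Proof.
split=> [[Rg <-]|[x [Ax Bfx nz]]].
  have /gfun_nz[x Ax nz] := set_mem Rg.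
  by exists x; split=> //; apply: L_degP; exists x.
have Rg : L_dom f g by apply/gfun_nz; exists x.
exists (mem_set Rg) => /=.
by apply: gr_disjoint nz => //; apply: L_degP; exists x.
Qed.

Lemma dprs_L (A B : grading F) (f : graded_hom A B) p :
  dprs (L_hom f) p <->
  exists x y, [/\ gr_comp A p.1 x, gr_comp A p.2 y & amul (f x) (f y) <> 0].
Proof.
split=> [[_ _ /prod_nonzero[_ [_ [[x Ax <-] [y Ay <-] nz]]]]|].
  by exists x, y.
move=> [x [y [Ax Ay nz]]]; split.
- by apply/gfun_nz; exists x => // fx0; apply: nz; rewrite fx0 amul0l.
- by apply/gfun_nz; exists y => // fy0; apply: nz; rewrite fy0 amul0r.
- by apply/prod_nonzero; exists (f x), (f y); split.
Qed.

(** The witnesses x, y for L(f1 f2) serve again: x, y for L(f2) and f2 x, f2 y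
    for L(f1), with [L_deg f2] giving the intermediate degrees. *)
Lemma prec_L_comp (A B C : grading F) (f1 : graded_hom B C)
    (f2 : graded_hom A B) :
  @prec (L_ob A) (L_ob C) (L_hom (graded_comp f1 f2))
    (triple_comp (L_hom f1) (L_hom f2)).
Proof.
have nz2 x : f1 (f2 x) <> 0 -> f2 x <> 0.
  by move=> nz f20; apply: nz; rewrite f20 gfun0.
have deg2 g x : gr_comp A g x -> gr_comp B (L_deg f2 g) (f2 x).
  by move=> Ax; apply: L_degP; exists x.
apply/precE; split=> [g k|[g h]].
  move=> /graph_L[x [Ax Cx nz]]; apply/graph_comp; exists (L_deg f2 g).
    by apply/graph_L; exists x; split; [|exact: deg2|exact: nz2].
  by apply/graph_L; exists (f2 x); split=> //; exact: deg2.
move=> /dprs_L[x [y [/= Ax Ay nz]]]; apply/dprs_comp; split.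
  apply/dprs_L; exists x, y; split=> // xy0.
  by apply: nz; rewrite -gfun_mul xy0 gfun0.
exists (L_deg f2 g), (L_deg f2 h); split.
- apply/graph_L; exists x; split; [by []|exact: deg2|apply: nz2 => x0].
  by apply: nz; rewrite x0 amul0l.
- apply/graph_L; exists y; split; [by []|exact: deg2|apply: nz2 => y0].
  by apply: nz; rewrite y0 amul0r.
- by apply/dprs_L; exists (f2 x), (f2 y); split=> //; exact: deg2.
Qed.

Lemma prec_L_id (A : grading F) :
  @prec (L_ob A) (L_ob A) (L_hom (graded_id A)) (triple_id (L_ob A)).
Proof.
apply/precE; split=> [g h|p].
  move=> /graph_L[x [Ax Ax' nz]]; apply/graph_id; split; first exact: gr_supp nz.
  exact: gr_disjoint nz.
by move=> /dprs_L[x [y [Ax Ay nz]]]; apply/prod_nonzero; exists x, y.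
Qed.

Lemma prec_L_eq (A B : GrAlg F) (f g : mor A B) : f = g -> prec (L1 f) (L1 g).
Proof. by move=> ->; exact: pe_refl prec_enriched _ _ _. Qed.

(** Every coherence condition equates two proofs of one inequality. *)
Lemma L_oplax :
  @oplax_functor (discrete_two_category (GrAlg_category F))
    (poset_two_category prec_enriched) (@L0 F) (@L1 F).
Proof.
by apply: (@OplaxFunctor (discrete_two_category (GrAlg_category F))
    (poset_two_category prec_enriched) (@L0 F) (@L1 F) prec_L_eq _ _
    (fun A B C f1 f2 => prec_L_comp f1 f2) prec_L_id) => * /=;
  exact: Prop_irrelevance.
Qed.

End LMapGraph.

Theorem mainTheorem3 (F : fieldType) :
  exists hC : is_poset_enriched prec,
    inhabited (@oplax_functor (discrete_two_category (GrAlg_category F))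
                 (poset_two_category hC) (@L0 F) (@L1 F)) /\
    (forall (A B C : GrAlg F) (f1 : mor B C) (f2 : mor A B),
       prec (L1 (cmp f1 f2)) (cmp (L1 f1) (L1 f2))).
Proof.
exists prec_enriched; split; first exact: (inhabits (L_oplax F)).
by move=> A B C f1 f2; exact: prec_L_comp.
Qed.
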